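(* Let $n \geq 1$ and let $K \subset \mathbb{R}^n$ be a compact convex body with smooth boundary. Then for any $\varepsilon > 0$ there exists a set $S \subset \mathbb{R}^n$ with $|S| = n+1$ that illuminates $K$ and satisfies $$d(S,K) \leq \sqrt{\frac{n(n+1)}{2}}\, D(K) + \varepsilon .$$
   Context: $\|\cdot\|$ is the Euclidean norm on $\mathbb{R}^n$. A compact convex body is a compact convex subset of $\mathbb{R}^n$ with nonempty interior; $\partial K$ is its boundary and $\mathrm{int}(K)$ its interior. $K$ has smooth boundary if there is a unique support hyperplane to $K$ at each point of $\partial K$. A point $x \in \mathbb{R}^n$ illuminates a point $y \in \partial K$ (with $x \neq y$) if the line segment connecting $x$ and $y$ does not intersect $\mathrm{int}(K)$, but the line containing this segment intersects $\mathrm{int}(K)$. A set $S \subset \mathbb{R}^n$ illuminates $K$ if every $y \in \partial K$ is illuminated by some $x \in S$. For a finite set $S$ that illuminates $K$, the illumination distance is $d(S,K) = \max\{\|x-y\| : x \in S,\ y \in K\}$. The diameter of $K$ is $D(K) = \max\{\|x-y\| : x,y \in K\}$. *)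

(* Defs.v *)
From mathcomp Require Import all_boot all_order all_algebra.
From mathcomp Require Import all_classical all_reals all_analysis.
Import Order.TTheory GRing.Theory Num.Theory.
Import numFieldNormedType.Exports.

Set Implicit Arguments.
Unset Strict Implicit.
Unset Printing Implicit Defensive.

Local Open Scope classical_set_scope.
Local Open Scope ring_scope.

(* Pitfall: the library norm `|x| on 'rV[R]_n is the sup norm, so lengths are
   measured with [enorm] instead.  The library topology on 'rV[R]_n (used for
   interior, closure and compactness) is the product topology, which is the
   Euclidean one. *)
Definition dotv (R : realType) (n : nat) (u v : 'rV[R]_n) : R :=
  \sum_(i < n) u 0 i * v 0 i.

Definition enorm (R : realType) (n : nat) (x : 'rV[R]_n) : R :=
  Num.sqrt (dotv x x).

Definition boundary (T : topologicalType) (A : set T) : set T :=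
  closure A `\` interior A.

Definition compact_convex_body (R : realType) (n : nat) (K : set 'rV[R]_n) :
    Prop :=
  [/\ compact K, convex_set K & interior K !=set0].

Definition support_hyperplane (R : realType) (n : nat) (K : set 'rV[R]_n)
    (y : 'rV[R]_n) (H : set 'rV[R]_n) : Prop :=
  H y /\
  exists (u : 'rV[R]_n) (c : R),
    [/\ u != 0, H = [set z | dotv u z = c] & K `<=` [set z | dotv u z <= c]].

(* Uniqueness is that of the hyperplane as a set of points, not of the pair
   (u, c) describing it. *)
Definition smooth_boundary (R : realType) (n : nat) (K : set 'rV[R]_n) :
    Prop :=
  forall y, boundary K y -> exists! H : set 'rV[R]_n, support_hyperplane K y H.

Definition segment (R : realType) (n : nat) (x y : 'rV[R]_n) :
    set 'rV[R]_n :=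
  [set (1 - t) *: x + t *: y | t in `[0, 1]].

Definition line (R : realType) (n : nat) (x y : 'rV[R]_n) : set 'rV[R]_n :=
  [set (1 - t) *: x + t *: y | t in [set: R]].

Definition illuminates_point (R : realType) (n : nat) (K : set 'rV[R]_n)
    (x y : 'rV[R]_n) : Prop :=
  [/\ x <> y, segment x y `&` interior K = set0
    & line x y `&` interior K !=set0].

Definition illuminates (R : realType) (n : nat) (S K : set 'rV[R]_n) : Prop :=
  forall y, boundary K y -> exists2 x, S x & illuminates_point K x y.

(* For S finite nonempty and K compact nonempty the two suprema below are
   attained, i.e. they are maxima. *)
Definition illumination_distance (R : realType) (n : nat)
    (S K : set 'rV[R]_n) : R :=
  sup [set enorm (x - y) | x in S & y in K].

Definition diameter (R : realType) (n : nat) (K : set 'rV[R]_n) : R :=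
  sup [set enorm (x - y) | x in K & y in K].

(* Main.v *)
(* Illumination at a smooth boundary point [y] is easy: a point strictly outside
   the unique support hyperplane at [y] illuminates [y].  If [K] lies in the
   interior of a simplex, then for every [y] some vertex of the simplex is
   strictly outside that hyperplane, so the vertices illuminate [K].  By Jung's
   theorem [K] lies in a ball of radius [r = D(K) * sqrt (n / (2 (n+1)))]; a
   regular simplex circumscribed about a slightly larger concentric ball has its
   vertices at distance about [n r] from the centre, hence at distance at most
   about [(n + 1) r = sqrt (n (n + 1) / 2) D(K)] from the points of [K].
   Jung's theorem is obtained by maximising the variance of a probability on
   [n+1] points of [K]; the slack [eps] makes an almost maximiser sufficient. *)
Require Import Defs.
From mathcomp Require Import all_boot all_order all_algebra.
From mathcomp Require Import all_classical all_reals all_analysis.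
From mathcomp Require Import ring lra.
Import Order.TTheory GRing.Theory Num.Theory.
Import numFieldNormedType.Exports.

Local Open Scope classical_set_scope.
Local Open Scope ring_scope.

(** * The Euclidean inner product and norm *)

Section EuclideanGeometry.
Context {R : realType} {n : nat}.
Implicit Types u v w : 'rV[R]_n.

Lemma dotvE u v : dotv u v = (u *m v^T) 0 0.
Proof. by rewrite mxE; apply: eq_bigr => i _; rewrite mxE. Qed.

Lemma dotvC u v : dotv u v = dotv v u.
Proof. by apply: eq_bigr => i _; rewrite mulrC. Qed.

Lemma dotvDl u v w : dotv (u + v) w = dotv u w + dotv v w.
Proof. by rewrite !dotvE mulmxDl mxE. Qed.

Lemma dotvNl u v : dotv (- u) v = - dotv u v.
Proof. by rewrite !dotvE mulNmx mxE. Qed.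

Lemma dotvZl (a : R) u v : dotv (a *: u) v = a * dotv u v.
Proof. by rewrite !dotvE -scalemxAl mxE. Qed.

Lemma dotvDr u v w : dotv w (u + v) = dotv w u + dotv w v.
Proof. by rewrite dotvC dotvDl !(dotvC w). Qed.

Lemma dotvNr u v : dotv v (- u) = - dotv v u.
Proof. by rewrite dotvC dotvNl dotvC. Qed.

Lemma dotvZr (a : R) u v : dotv v (a *: u) = a * dotv v u.
Proof. by rewrite dotvC dotvZl dotvC. Qed.

Lemma dotv0l u : dotv 0 u = 0.
Proof. by rewrite dotvE mul0mx mxE. Qed.

Definition dotv_lin := (dotvDl, dotvDr, dotvNl, dotvNr, dotvZl, dotvZr).

Lemma dotv_suml (I : finType) (F : I -> 'rV[R]_n) u :
  dotv (\sum_i F i) u = \sum_i dotv (F i) u.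
Proof.
elim/big_rec2: _ => [|i a b _ <-]; first exact: dotv0l.
exact: dotvDl.
Qed.

Lemma dotv_ge0 u : 0 <= dotv u u.
Proof. by apply: sumr_ge0 => i _; rewrite -expr2 sqr_ge0. Qed.

Lemma dotv_eq0 u : (dotv u u == 0) = (u == 0).
Proof.
apply/idP/eqP => [|->]; last by rewrite dotv0l.
rewrite psumr_eq0 => [|i _]; last by rewrite -expr2 sqr_ge0.
move=> /allP u0; apply/rowP => i; rewrite mxE.
by have := u0 i (mem_index_enum _); rewrite /= mulf_eq0 orbb => /eqP.
Qed.

Lemma dotv_gt0 u : u != 0 -> 0 < dotv u u.
Proof. by move=> u0; rewrite lt_neqAle eq_sym dotv_eq0 u0 dotv_ge0. Qed.

Lemma enorm_ge0 u : 0 <= enorm u.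
Proof. exact: sqrtr_ge0. Qed.

Lemma enorm_sqr u : enorm u ^+ 2 = dotv u u.
Proof. by rewrite sqr_sqrtr ?dotv_ge0. Qed.

Lemma enorm_gt0 u : u != 0 -> 0 < enorm u.
Proof. by move=> u0; rewrite sqrtr_gt0 dotv_gt0. Qed.

(** Cauchy-Schwarz, from expanding the squared norm of [dotv u u *: v - dotv u v *: u]. *)
Lemma dotv_le_enorm u v : dotv u v <= enorm u * enorm v.
Proof.
have [->|u0] := eqVneq u 0; first by rewrite dotv0l mulr_ge0 ?enorm_ge0.
have uu := dotv_gt0 u u0.
have h := dotv_ge0 (dotv u u *: v - dotv u v *: u).
have {}h : 0 <= dotv u u * (dotv u u * dotv v v - dotv u v ^+ 2).
  move: h; rewrite !dotv_lin (dotvC v u); congr (0 <= _); ring.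
rewrite pmulr_rge0 // subr_ge0 in h.
have := mulr_ge0 (enorm_ge0 u) (enorm_ge0 v); move: h.
by rewrite -!enorm_sqr -exprMn; set a := _ * _; set b := dotv _ _; nra.
Qed.

Lemma enormD u v : enorm (u + v) <= enorm u + enorm v.
Proof.
have h := dotv_le_enorm u v.
rewrite -(@ler_pXn2r _ 2) ?nnegrE ?addr_ge0 ?enorm_ge0 //.
rewrite enorm_sqr !dotv_lin (dotvC v u) sqrrD -!enorm_sqr.
lra.
Qed.

Lemma enormZ (a : R) u : enorm (a *: u) = `|a| * enorm u.
Proof.
by rewrite /enorm !dotv_lin mulrA -expr2 sqrtrM ?sqr_ge0 // sqrtr_sqr.
Qed.

Lemma enormN u : enorm (- u) = enorm u.
Proof. by rewrite -scaleN1r enormZ normrN1 mul1r. Qed.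

(** * Weighted point systems: barycenter and variance *)

Section Variance.
Context {m : nat}.
Implicit Types (a : 'I_m -> R) (z : 'I_m -> 'rV[R]_n).

Definition barycenter a z : 'rV[R]_n := \sum_i a i *: z i.

Definition variance a z : R :=
  \sum_i a i * dotv (z i) (z i) - dotv (barycenter a z) (barycenter a z).

Definition weights a : Prop := (forall i, 0 <= a i) /\ \sum_i a i = 1.

(** The parallel axis identity: about the barycenter the cross terms cancel, so only its squared
    distance to [u] is added. *)
Lemma sum_sqdist a z u : \sum_i a i = 1 ->
  \sum_i a i * dotv (z i - u) (z i - u)
  = variance a z + dotv (barycenter a z - u) (barycenter a z - u).
Proof.
move=> a1; rewrite /variance.
transitivity (\sum_i (a i * dotv (z i) (z i)) -
   2 * \sum_i (a i * dotv (z i) u) + (\sum_i a i) * dotv u u).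
  rewrite mulr_sumr mulr_suml -sumrB -big_split /=; apply: eq_bigr => i _.
  rewrite !dotv_lin (dotvC u); ring.
have -> : \sum_i (a i * dotv (z i) u) = dotv (barycenter a z) u.
  by rewrite dotv_suml; apply: eq_bigr => i _; rewrite dotvZl.
rewrite a1 !dotv_lin (dotvC u); ring.
Qed.

(** Averaging [sum_sqdist] over [u = z j] with weights [a j] produces the variance twice. *)
Lemma variance_pairs a z : \sum_i a i = 1 ->
  2 * variance a z
  = \sum_j a j * \sum_i a i * dotv (z i - z j) (z i - z j).
Proof.
move=> a1.
under eq_bigr => j _ do rewrite sum_sqdist // mulrDr.
rewrite big_split /= -mulr_suml a1 mul1r.
have -> : \sum_j a j * dotv (barycenter a z - z j) (barycenter a z - z j)
  = \sum_j a j * dotv (z j - barycenter a z) (z j - barycenter a z).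
  by apply: eq_bigr => j _; rewrite -opprB dotvNl dotvNr opprK.
rewrite sum_sqdist // subrr dotv0l; ring.
Qed.

Lemma sum_sqr_weights a : (0 < m)%N -> \sum_i a i = 1 ->
  m%:R^-1 <= \sum_i a i ^+ 2.
Proof.
move=> m0 a1.
have mR : (m%:R : R) != 0 by rewrite pnatr_eq0 -lt0n.
rewrite -subr_ge0.
have -> : \sum_i a i ^+ 2 - m%:R^-1 = \sum_i (a i - m%:R^-1) ^+ 2.
  transitivity (\sum_i (a i ^+ 2 - 2 / m%:R * a i + m%:R^-1 ^+ 2)); last first.
    by apply: eq_bigr => i _; ring.
  rewrite big_split sumrB /= -mulr_sumr a1 sumr_const card_ord.
  by rewrite -[_ *+ m]mulr_natr; field.
by apply: sumr_ge0 => i _; rewrite sqr_ge0.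
Qed.

(** The diagonal pairs contribute nothing, so [a j] meets only the total weight [1 - a j] of the
    other points. With [m = n.+1] this is the source of Jung's constant. *)
Lemma variance_le a z (D2 : R) : (0 < m)%N -> weights a -> 0 <= D2 ->
  (forall i j, dotv (z i - z j) (z i - z j) <= D2) ->
  2 * variance a z <= D2 * (1 - m%:R^-1).
Proof.
move=> m0 [a0 a1] D0 hD; rewrite variance_pairs //.
apply: (@le_trans _ _ (\sum_j a j * (D2 * (1 - a j)))).
  apply: ler_sum => j _; apply: ler_wpM2l => //.
  rewrite (bigD1 j) //= subrr dotv0l mulr0 add0r.
  have -> : 1 - a j = \sum_(i | i != j) a i by rewrite -a1 (bigD1 j) //=; ring.
  rewrite mulr_sumr; apply: ler_sum => i _.
  by rewrite mulrC; apply: ler_wpM2r.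
have -> : \sum_j a j * (D2 * (1 - a j)) = D2 * (1 - \sum_j a j ^+ 2).
  rewrite -{2}a1 -sumrB mulr_sumr; apply: eq_bigr => j _; ring.
apply: ler_wpM2l => //; rewrite lerD2l lerN2; exact: sum_sqr_weights.
Qed.

End Variance.
End EuclideanGeometry.

(** * Jung's theorem up to an arbitrarily small error *)

Section Jung.
Context {R : realType} {n : nat}.

(** The [n.+2] rows [(1, z i)] lie in a space of dimension [n.+1], hence are linearly dependent. *)
Lemma affine_dependency (z : 'I_n.+2 -> 'rV[R]_n) :
  exists f : 'I_n.+2 -> R,
    [/\ exists i, f i != 0, \sum_i f i = 0 & \sum_i f i *: z i = 0].
Proof.
pose Z : 'M[R]_(n.+2, n) := \matrix_(i, k) z i 0 k.
pose A := row_mx (const_mx 1 : 'cV[R]_n.+2) Z.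
have /rowV0Pn[v /sub_kermxP] : kermx A != 0.
  rewrite -mxrank_eq0 mxrank_ker -lt0n subn_gt0.
  exact: leq_ltn_trans (rank_leq_col A) _.
rewrite mul_mx_row -row_mx0 => /eq_row_mx[v1 vZ] v0.
exists (fun i => v 0 i); split.
- by move/rV0Pn: v0.
- have /rowP/(_ 0) := v1; rewrite !mxE; apply: etrans.
  by apply: eq_bigr => i _; rewrite mxE mulr1.
- rewrite -[RHS]vZ; apply/rowP => k; rewrite summxE [RHS]mxE.
  by apply: eq_bigr => i _; rewrite !mxE.
Qed.

(* Along an affine dependency the barycenter is fixed, so the variance is an
   affine function; moving in the direction in which it does not decrease until
   a weight vanishes frees one of the points. *)
Lemma variance_caratheodory (a : 'I_n.+2 -> R) (z : 'I_n.+2 -> 'rV[R]_n) :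
  weights a -> exists j b, [/\ weights b, b j = 0 & variance a z <= variance b z].
Proof.
move=> [a0 a1]; have [f0 [[k k0] f01 f0z]] := affine_dependency z.
have [f [[{}k {}k0] f1 fz fv]] : exists f : 'I_n.+2 -> R,
    [/\ exists i, f i != 0, \sum_i f i = 0, \sum_i f i *: z i = 0
      & 0 <= \sum_i f i * dotv (z i) (z i)].
  have [h|h] := leP 0 (\sum_i f0 i * dotv (z i) (z i)).
    by exists f0; split => //; exists k.
  exists (fun i => - f0 i); split.
  - by exists k; rewrite oppr_eq0.
  - by rewrite sumrN f01 oppr0.
  - by under eq_bigr => i _ do rewrite scaleNr; rewrite sumrN f0z oppr0.
  - under eq_bigr => i _ do rewrite mulNr.
    by rewrite sumrN oppr_ge0 ltW.
have [i0 i00] : exists i, f i < 0.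
  apply: contrapT => fN.
  have f_ge0 i : 0 <= f i.
    by rewrite leNgt; apply/negP => fi; apply: fN; exists i.
  move/eqP: f1; rewrite psumr_eq0 // => /allP/(_ k (mem_index_enum _)) /=.
  by rewrite (negbTE k0).
(* The minimal ratio is the largest multiple of [f] that keeps all weights nonnegative; the weight
   at the minimiser [j] drops to 0. *)
case: (@arg_minP _ R _ i0 [pred i | f i < 0] (fun i => a i / - f i) i00).
move=> j /= fj jmin; set s := a j / - f j in jmin.
have s0 : 0 <= s by rewrite divr_ge0 // oppr_ge0 ltW.
exists j, (fun i => a i + s * f i); split.
- split => [i|]; last by rewrite big_split /= -mulr_sumr f1 mulr0 addr0.
  have [fi|fi] := leP 0 (f i); first by rewrite addr_ge0 // mulr_ge0.
  have := jmin i fi; rewrite ler_pdivlMr ?oppr_gt0 // mulrN.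
  by rewrite -subr_ge0 opprK.
- by rewrite /s; field; rewrite lt_eqF.
- rewrite /variance.
  have -> : barycenter (fun i => a i + s * f i) z = barycenter a z.
    rewrite /barycenter; under eq_bigr => i _ do rewrite scalerDl -scalerA.
    by rewrite big_split /= -scaler_sumr fz scaler0 addr0.
  rewrite lerD2r; under [leRHS]eq_bigr => i _ do rewrite mulrDl -mulrA.
  by rewrite big_split /= -mulr_sumr lerDl mulr_ge0.
Qed.

Lemma variance_lift {m} (j : 'I_m.+1) (b : 'I_m.+1 -> R)
    (z : 'I_m.+1 -> 'rV[R]_n) : weights b -> b j = 0 ->
  weights (b \o lift j) /\ variance (b \o lift j) (z \o lift j) = variance b z.
Proof.
move=> [b0 b1] bj; split; first split => [i|]; first exact: b0.
  by rewrite -b1 (bigD1_ord j) //= bj add0r.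
rewrite /variance /barycenter [in RHS](bigD1_ord j) //= bj mul0r add0r.
by congr (_ - dotv _ _); rewrite [RHS](bigD1_ord j) //= bj scale0r add0r.
Qed.

(** The new point [x], of mass [t], takes index [ord0]. At [t = 0] the variance grows at the rate of
    the squared distance from [x] to the barycenter minus the variance, so near-maximality bounds
    that distance. *)
Lemma variance_mix {m} (a : 'I_m -> R) (z : 'I_m -> 'rV[R]_n) (x : 'rV[R]_n)
    (t : R) : weights a -> 0 <= t <= 1 ->
  let b k := oapp (fun i => (1 - t) * a i) t (unlift ord0 k) in
  let y k := oapp z x (unlift ord0 k) in
  weights b /\ variance b y = (1 - t) * variance a z +
    t * (1 - t) * dotv (x - barycenter a z) (x - barycenter a z).
Proof.
move=> [a0 a1] /andP[t0 t1] b y.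
have bE i : b (lift ord0 i) = (1 - t) * a i by rewrite /b liftK.
have yE i : y (lift ord0 i) = z i by rewrite /y liftK.
have b0 : b ord0 = t by rewrite /b unlift_none.
have y0 : y ord0 = x by rewrite /y unlift_none.
split; first split.
- move=> k; rewrite /b; case: unliftP => [i|] _ //=.
  by rewrite mulr_ge0 // subr_ge0.
- rewrite big_ord_recl b0; under eq_bigr => i _ do rewrite bE.
  by rewrite -mulr_sumr a1; ring.
have bary : barycenter b y = t *: x + (1 - t) *: barycenter a z.
  rewrite /barycenter big_ord_recl b0 y0 scaler_sumr; congr (_ + _).
  by apply: eq_bigr => i _; rewrite bE yE scalerA.
rewrite /variance bary big_ord_recl b0 y0.
under eq_bigr => i _ do rewrite bE yE -mulrA.
rewrite -mulr_sumr !dotv_lin (dotvC _ x); ring.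
Qed.

(* The centre is the barycenter of [n.+1] weighted points of [K] of almost
   maximal variance: putting a small mass at a point far from the barycenter
   would increase the variance. *)
Lemma jung_approx (K : set 'rV[R]_n) (D2 eta : R) : K !=set0 -> 0 < eta ->
  (forall x y, K x -> K y -> dotv (x - y) (x - y) <= D2) ->
  exists c, forall x, K x ->
    dotv (x - c) (x - c) <= D2 * n%:R / (2 * n.+1%:R) + eta.
Proof.
move=> [x0 Kx0] eta0 KD.
have D0 : 0 <= D2 by apply: le_trans (KD _ _ Kx0 Kx0); exact: dotv_ge0.
pose E := [set v | exists a (z : 'I_n.+1 -> 'rV[R]_n),
  [/\ weights a, forall i, K (z i) & v = variance a z]].
pose V := D2 * n%:R / (2 * n.+1%:R).
have EV v : E v -> v <= V.
  move=> [a [z [wa Kz ->]]].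
  have := @variance_le R n _ a z D2 isT wa D0 (fun i j => KD _ _ (Kz i) (Kz j)).
  suff -> : V = 2^-1 * (D2 * (1 - n.+1%:R^-1)) by rewrite ler_pdivlMl.
  by rewrite /V -natr1; field; rewrite nat1r pnatr_eq0.
have E0 : E !=set0.
  pose a (i : 'I_n.+1) : R := (i == ord0)%:R.
  exists (variance a (fun=> x0)), a, (fun=> x0); split => //; split => [i|].
    by rewrite ler0n.
  by rewrite (bigD1 ord0) //= /a eqxx big1 ?addr0 // => i /negbTE ->.
have Esup : has_sup E by split => //; exists V => v; exact: EV.
(* The squared distance [d] will satisfy [d < variance a z + eta / 2 + t * d] with [d <= D2]; this
   [t] makes the last term at most [eta / 2]. The tolerance [t * eta / 2] for the almost maximiser
   becomes [eta / 2] after division by [t]. *)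
pose t := eta / (2 * (D2 + eta)).
have De : 0 < D2 + eta by lra.
have t0 : 0 < t by rewrite divr_gt0 // mulr_gt0.
have tDe : t * (D2 + eta) = eta / 2 by rewrite /t; field; lra.
have t1 : t <= 1 by rewrite ler_pdivrMr ?mulr_gt0 // mul1r; lra.
have e0 : 0 < t * eta / 2 by rewrite !divr_gt0 // mulr_gt0.
have [_ [a [z [wa Kz ->]]] aV] := sup_adherent e0 Esup.
exists (barycenter a z) => x Kx.
have va : variance a z <= V by apply: EV; exists a, z.
have va0 : 0 <= variance a z.
  have [ap a1] := wa.
  have := sum_sqdist a z (barycenter a z) a1.
  rewrite subrr dotv0l addr0 => <-; apply: sumr_ge0 => i _.
  by rewrite mulr_ge0 // dotv_ge0.
have dD : dotv (x - barycenter a z) (x - barycenter a z) <= D2.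
  have [ap a1] := wa.
  have := sum_sqdist a z x a1.
  rewrite -(opprB x (barycenter _ _)) dotvNl dotvNr opprK => eq1.
  have : \sum_i a i * dotv (z i - x) (z i - x) <= D2.
    rewrite -[leRHS]mul1r -a1 mulr_suml; apply: ler_sum => i _.
    by apply: ler_wpM2l => //; exact: KD.
  by rewrite eq1; apply: le_trans; rewrite lerDr.
have [] := variance_mix a z x t wa; first by rewrite (ltW t0) t1.
set b := fun k : 'I_n.+2 => _; set y := fun k : 'I_n.+2 => _ => wb vb.
(* The mixture has [n.+2] points; discarding one without losing variance makes it comparable with
   [sup E]. *)
have [j [b' [wb' b'j vb']]] := variance_caratheodory b y wb.
have [wl vl] := variance_lift j b' y wb' b'j.
have : variance b' y <= sup E.
  rewrite -vl; apply: ub_le_sup; first by case: Esup.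
  exists (b' \o lift j), (y \o lift j); split => // i.
  by rewrite /= /y; case: unliftP => [k|] _ /=.
move=> /(le_trans vb'); rewrite vb => /le_lt_trans.
move: (dotv _ _) dD => d dD; rewrite ltrBlDr in aV.
move=> /(_ _ aV) h.
have {}h : (1 - t) * d < variance a z + eta / 2.
  by rewrite -(ltr_pM2l t0); lra.
have td : t * d <= t * D2 by rewrite ler_pM2l.
rewrite -/V; nra.
Qed.

End Jung.

(** * The regular simplex and its inradius *)

Section RegularSimplex.
Context {R : realType} {n : nat}.

(* In coordinates: the multiple [- n^-1/2 (1, .., 1)] and the [n] translates
   [alpha e_i - beta (1, .., 1)], with [alpha] and [beta] making all pairwise
   inner products equal to [- 1/n]. *)
Lemma regular_simplex : (0 < n)%N ->
  exists v : 'I_n.+1 -> 'rV[R]_n,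
    [/\ injective v, forall k, dotv (v k) (v k) = 1,
        forall u, \sum_k dotv u (v k) = 0
      & forall u, \sum_k dotv u (v k) ^+ 2 = n.+1%:R / n%:R * dotv u u].
Proof.
move=> n0.
have nR : 0 < n%:R :> R by rewrite ltr0n.
have n1R : 1 <= n%:R :> R by rewrite ler1n.
pose r : R := Num.sqrt n%:R; pose q : R := Num.sqrt n.+1%:R.
have r0 : 0 < r by rewrite sqrtr_gt0.
have q0 : 0 < q by rewrite sqrtr_gt0 ltr0n.
have r2 : n%:R = r ^+ 2 by rewrite sqr_sqrtr // ltW.
have q2 : r ^+ 2 + 1 = q ^+ 2 by rewrite -r2 natr1 sqr_sqrtr.
have nS : n.+1%:R = q ^+ 2 by rewrite -q2 -r2 natr1.
(* Squared edge length [2 + 2/n] forces [al ^+ 2 = 1 + 1/n]; inner product [-1/n] with [v ord0]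
   forces [al - be * n = r^-1]. *)
pose al := q / r; pose be := (q - 1) / (r ^+ 2 * r).
pose one : 'rV[R]_n := const_mx 1.
pose e i : 'rV[R]_n := delta_mx 0 i.
pose w i := al *: e i - be *: one.
pose v k := oapp w (- r^-1 *: one) (unlift ord0 k).
have v0 : v ord0 = - r^-1 *: one by rewrite /v unlift_none.
have vl i : v (lift ord0 i) = w i by rewrite /v liftK.
have dote u i : dotv u (e i) = u 0 i.
  rewrite /dotv (bigD1 i) //= big1 => [|j /negbTE ji].
    by rewrite mxE !eqxx mulr1 addr0.
  by rewrite mxE ji andbF mulr0.
have dot1 u : dotv u one = \sum_i u 0 i.
  by apply: eq_bigr => i _; rewrite mxE mulr1.
have dot11 : dotv one one = r ^+ 2.
  rewrite dot1; under eq_bigr => i _ do rewrite mxE.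
  by rewrite sumr_const card_ord r2.
have rn0 : r != 0 by rewrite gt_eqF.
have dotw u i : dotv u (w i) = al * u 0 i - be * dotv u one.
  by rewrite /w !dotv_lin dote.
exists v; split.
- move=> k l; case: (unliftP ord0 k) => [i|] ->; case: (unliftP ord0 l) => [j|] ->;
    rewrite ?v0 ?vl //.
  + move=> /rowP/(_ i); rewrite !mxE !eqxx /=.
    case: eqP => [-> //|_] /eqP.
    rewrite subr_eq subrK mulr1 mulr0 /al mulf_eq0 invr_eq0.
    by rewrite (gt_eqF r0) (gt_eqF q0).
  + move=> /rowP/(_ i); rewrite !mxE !eqxx !mulr1 => /eqP.
    rewrite -subr_eq0 opprK.
    have -> : al - be + r^-1 = (r ^+ 2 * q - (q - 1) + r ^+ 2) / (r ^+ 2 * r).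
      by rewrite /al /be; field.
    rewrite gt_eqF // divr_gt0 // ?mulr_gt0 ?exprn_gt0 // -r2; nra.
  + move=> /rowP/(_ j); rewrite !mxE !eqxx !mulr1 => /eqP.
    rewrite eq_sym -subr_eq0 opprK.
    have -> : al - be + r^-1 = (r ^+ 2 * q - (q - 1) + r ^+ 2) / (r ^+ 2 * r).
      by rewrite /al /be; field.
    rewrite gt_eqF // divr_gt0 // ?mulr_gt0 ?exprn_gt0 // -r2; nra.
- move=> k; case: (unliftP ord0 k) => [i|] ->; rewrite ?v0 ?vl; last first.
    by rewrite !dotv_lin dot11; field.
  rewrite dotw dotvC dotw !mxE !eqxx dot11 !mulr1.
  transitivity ((r ^+ 2 * q ^+ 2 - q ^+ 2 + 1) / (r ^+ 2 * r ^+ 2)).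
    by rewrite /al /be; field.
  by rewrite -q2; field.
- move=> u; rewrite big_ord_recl v0 dotvZr.
  under eq_bigr => i _ do rewrite vl dotw.
  rewrite sumrB -mulr_sumr sumr_const card_ord -dot1 -mulr_natr r2.
  by rewrite /al /be; field.
- move=> u; rewrite big_ord_recl v0 dotvZr.
  transitivity ((- r^-1 * dotv u one) ^+ 2 +
    \sum_i (al ^+ 2 * (u 0 i * u 0 i) + (- 2 * al * be * dotv u one) * u 0 i
      + (be * dotv u one) ^+ 2)).
    by congr (_ + _); apply: eq_bigr => i _; rewrite vl dotw; ring.
  rewrite !big_split /= -!mulr_sumr sumr_const card_ord -dot1 -[_ *+ n]mulr_natr.
  rewrite -/(dotv u u) nS r2 /al /be.
  (* The coefficient of [dotv u one ^+ 2] vanishes because [r ^+ 2 + 1 = q ^+ 2]. *)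
  transitivity ((r ^+ 2 - (q ^+ 2 - 1)) / r ^+ 4 * dotv u one ^+ 2
    + q ^+ 2 / r ^+ 2 * dotv u u); first by field.
  by rewrite -q2; field.
Qed.

(** In terms of support functions: the simplex with unit circumradius contains the ball of radius
    [1/n]. Otherwise the products of [dotv u (v k) + enorm u] and [enorm u / n - dotv u (v k)] are
    nonnegative and, by the two moment identities, sum to 0. Then every [dotv u (v k)] is
    [- enorm u], and their zero sum gives [enorm u = 0], against strictness. *)
Lemma simplex_inradius (v : 'I_n.+1 -> 'rV[R]_n) (u : 'rV[R]_n) : (0 < n)%N ->
  (forall k, dotv (v k) (v k) = 1) -> \sum_k dotv u (v k) = 0 ->
  \sum_k dotv u (v k) ^+ 2 = n.+1%:R / n%:R * dotv u u ->
  exists k, enorm u / n%:R <= dotv u (v k).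
Proof.
move=> n0 v1 s1 s2; apply: contrapT => hN.
have nR : 0 < n%:R :> R by rewrite ltr0n.
have ltk k : dotv u (v k) < enorm u / n%:R.
  by rewrite ltNge; apply/negP => h; apply: hN; exists k.
have gek k : 0 <= dotv u (v k) + enorm u.
  have := dotv_le_enorm (- u) (v k).
  by rewrite -scaleN1r enormZ dotvZl normrN1 {2}/enorm v1 sqrtr1; lra.
have : \sum_k (dotv u (v k) + enorm u) * (enorm u / n%:R - dotv u (v k)) = 0.
  transitivity (\sum_k (- (dotv u (v k) ^+ 2) +
     (enorm u / n%:R - enorm u) * dotv u (v k) + enorm u ^+ 2 / n%:R)).
    by apply: eq_bigr => k _; ring.
  rewrite !big_split /= sumrN -mulr_sumr s1 s2 sumr_const card_ord enorm_sqr.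
  by rewrite -[_ *+ n.+1]mulr_natr; field; rewrite gt_eqF.
move/eqP; rewrite psumr_eq0 => [/allP h|k _]; last first.
  by rewrite mulr_ge0 // subr_ge0 ltW.
have ek k : dotv u (v k) + enorm u = 0.
  have := h k (mem_index_enum _); rewrite /= mulf_eq0 subr_eq0 => /orP[/eqP//|].
  by rewrite (gt_eqF (ltk k)).
have u0 : enorm u = 0.
  have : \sum_k (dotv u (v k) + enorm u) = 0 by rewrite big1.
  rewrite big_split /= s1 add0r sumr_const card_ord => /eqP.
  by rewrite mulrn_eq0 => /eqP.
by have := ltk ord0; have := ek ord0; rewrite u0 mul0r addr0 => ->; rewrite ltxx.
Qed.

End RegularSimplex.

(** * Separating a convex body from a line that misses its interior *)

Section Separation.
Context {R : realType} {n : nat}.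

Lemma continuous_dotv {T : topologicalType} (f g : T -> 'rV[R]_n) :
  continuous f -> continuous g -> continuous (fun t => dotv (f t) (g t)).
Proof.
move=> cf cg; apply: continuous_big => [|i _ t]; first exact: add_continuous.
have coordP (h : T -> 'rV[R]_n) : continuous h -> h s 0 i @[s --> t] --> h t 0 i.
  move=> ch; apply: (@continuous_comp _ _ _ h (fun u : 'rV[R]_n => u 0 i)).
    exact: ch.
  exact: coord_continuous.
by apply: cvgM; exact: coordP.
Qed.

Lemma continuous_affine (a : R) (b : 'rV[R]_n) :
  continuous (fun z : 'rV[R]_n => a *: z + b).
Proof.
move=> z.
apply: (@continuousD _ _ _ (fun w : 'rV[R]_n => a *: w) (cst b)).
  exact: scaler_continuous.
exact: cst_continuous.
Qed.

Lemma compact_sphere : compact [set u : 'rV[R]_n | dotv u u = 1].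
Proof.
have box : compact [set v : 'rV[R]_n | forall i, v ord0 i \in `[(-1 : R), 1]].
  apply: (@rV_compact _ _ (fun=> `[(-1 : R), 1]%classic)) => _.
  exact: segment_compact.
apply: subclosed_compact box _ => [|u /= u1 i].
  have -> : [set u : 'rV[R]_n | dotv u u = 1]
    = (fun u : 'rV[R]_n => dotv u u) @^-1` [set x | x = 1] by [].
  apply: preimage_closed => [u _|]; last exact: closed_eq.
  by apply: continuous_dotv => ?; exact: cvg_id.
have : u 0 i ^+ 2 <= 1.
  rewrite -u1 /dotv (bigD1 i) //= expr2 lerDl.
  by apply: sumr_ge0 => j _; rewrite -expr2 sqr_ge0.
by rewrite in_itv /= => u2; apply/andP; split; nra.
Qed.

Section ConvexSet.
Variable K : set 'rV[R]_n.
Hypothesis K_convex : convex_set K.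

Lemma convex_segment (x y : 'rV[R]_n) (t : R) : K x -> K y -> 0 <= t <= 1 ->
  K ((1 - t) *: x + t *: y).
Proof.
move=> Kx Ky /andP[t0 t1].
have h0 : 0 <= 1 - t by rewrite subr_ge0.
have h1 : 1 - t <= 1 by rewrite gerBl.
have := K_convex x y (Itv01 h0 h1) (mem_set Kx) (mem_set Ky).
by rewrite inE /conv /= /unstable.onem subKr.
Qed.

(** The map [f] inverts the homothety of centre [x] and ratio [t]: it sends a neighbourhood of the
    new point into [K], and convexity brings that neighbourhood back into [K]. *)
Lemma convex_interior_segment (x p : 'rV[R]_n) (t : R) : K x -> K° p ->
  0 < t <= 1 -> K° ((1 - t) *: x + t *: p).
Proof.
move=> Kx Kp /andP[t0 t1].
have tn0 : t != 0 by rewrite gt_eqF.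
pose f (w : 'rV[R]_n) := t^-1 *: w + (- (t^-1 * (1 - t)) *: x).
have fE w : (1 - t) *: x + t *: f w = w.
  rewrite /f scalerDr !scalerA mulfV // scale1r mulrN mulrA mulfV // mul1r.
  by rewrite scaleNr addrCA subrr addr0.
have fm : f ((1 - t) *: x + t *: p) = p.
  rewrite /f scalerDr !scalerA mulVf // scale1r scaleNr.
  by rewrite addrAC subrr add0r.
have cf : {for (1 - t) *: x + t *: p, continuous f}.
  exact: continuous_affine.
have : nbhs ((1 - t) *: x + t *: p) (f @^-1` K).
  by apply: cf; rewrite fm.
apply: filterS => w /= Kfw; rewrite -(fE w); apply: convex_segment => //.
by rewrite (ltW t0).
Qed.

Lemma interior_dotv_lt (u z : 'rV[R]_n) (c : R) : u != 0 ->
  (forall x, K x -> dotv u x <= c) -> K° z -> dotv u z < c.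
Proof.
move=> u0 Kc Kz.
pose f (s : R) : 'rV[R]_n := s *: u + z.
have cf : f s @[s --> 0] --> z.
  rewrite -[X in _ --> X]add0r -(scale0r u).
  apply: (@continuousD _ _ _ (fun s : R => s *: u) (cst z)).
    exact: scalel_continuous.
  exact: cst_continuous.
have /cf/nbhs_ballP[e /= e0 eK] : nbhs z K by [].
have : K (f (e / 2)).
  by apply: eK; rewrite /ball /= sub0r normrN gtr0_norm ?divr_gt0 //; lra.
move=> /Kc; rewrite /f dotvDr dotvZr; apply: lt_le_trans.
by rewrite ltrDr mulr_gt0 ?divr_gt0 // dotv_gt0.
Qed.

End ConvexSet.

Lemma dotv_ge0_of_segment_min (g h : 'rV[R]_n) :
  (forall s : R, 0 <= s <= 1 -> dotv g g <= dotv (g + s *: h) (g + s *: h)) ->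
  0 <= dotv g h.
Proof.
move=> gmin; rewrite leNgt; apply/negP => gh.
have hh := dotv_ge0 h.
have den : 0 < dotv h h - dotv g h by rewrite subr_gt0; apply: lt_le_trans hh.
(* The extra [- dotv g h] in the denominator ensures [s <= 1], and moving by [s *: h] still shortens
   [g]. *)
pose s := - dotv g h / (dotv h h - dotv g h).
have s0 : 0 < s by rewrite divr_gt0 // oppr_gt0.
have s1 : s <= 1 by rewrite ler_pdivrMr // mul1r lerDr.
have sE : s * dotv h h = s * dotv g h - dotv g h.
  by rewrite /s; field; rewrite gt_eqF.
have := gmin s; rewrite (ltW s0) s1 => /(_ isT).
rewrite !dotv_lin (dotvC h g) => le1.
have : 0 <= s * (2 * dotv g h + s * dotv h h) by lra.
rewrite pmulr_rge0 // sE => le2.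
have : s * dotv g h < 0 by rewrite pmulr_rlt0.
lra.
Qed.

(* The functional is the one realising the distance from [y] to the projection
   of [K] along [d]. *)
Lemma separate_line_approx (K : set 'rV[R]_n) (y d p : 'rV[R]_n) (t : R) :
  compact K -> convex_set K -> d != 0 -> K° p -> 0 < t <= 1 ->
  (forall s, ~ K° (y + s *: d)) ->
  exists u, [/\ dotv u u = 1, dotv u d = 0 &
    forall z, K z -> dotv u ((1 - t) *: z + t *: p - y) <= 0].
Proof.
move=> Kc Kconv d0 Kp t01 Kyd.
have dd : dotv d d != 0 by rewrite dotv_eq0.
(* [P] is the orthogonal projection along [d]. The map [m] shrinks [K] towards the interior point
   [p] and takes [y] as origin; the shrunken body lies in the interior of [K], so it misses the line
   altogether. *)
pose P (w : 'rV[R]_n) := w - (dotv w d / dotv d d) *: d.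
pose m (z : 'rV[R]_n) := (1 - t) *: z + (t *: p - y).
have mE z : m z = (1 - t) *: z + t *: p - y by rewrite /m addrA.
have cm : continuous m by exact: continuous_affine.
have cP : continuous (P \o m).
  move=> z; apply: (@continuousB _ _ _ m
    (fun z => (dotv (m z) d / dotv d d) *: d)); first exact: cm.
  apply: continuousZr_tmp; apply: continuousM; last exact: cst_continuous.
  by apply: continuous_dotv => //; exact: cst_continuous.
have cf : continuous (fun z => dotv (P (m z)) (P (m z))).
  exact: continuous_dotv.
have [|z0] := EVT_min_rV _ Kc (continuous_subspaceT cf).
  by exists p; exact: nbhs_singleton.
rewrite inE => Kz0 z0min.
pose g := P (m z0).
have gd : dotv g d = 0.
  by rewrite /g /P !dotv_lin divfK ?subrr.
have gP w : dotv g (P w) = dotv g w.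
  by rewrite /P dotvDr dotvNr dotvZr gd mulr0 subr0.
have g0 : g != 0.
  apply/eqP => /eqP; rewrite subr_eq0 => /eqP mz0.
  apply: (Kyd (dotv (m z0) d / dotv d d)).
  rewrite -mz0 mE addrC subrK.
  exact: convex_interior_segment.
have gg := dotv_gt0 _ g0.
exists (- (enorm g)^-1 *: g); split.
- by rewrite dotvZl dotvZr -enorm_sqr; field; rewrite gt_eqF // enorm_gt0.
- by rewrite dotvZl gd mulr0.
- move=> z Kz; rewrite dotvZl -mE -gP mulNr oppr_le0.
  apply: mulr_ge0; first by rewrite invr_ge0 enorm_ge0.
  have -> : P (m z) = g + (P (m z) - g) by rewrite addrC subrK.
  rewrite dotvDr addr_ge0 ?(ltW gg) //.
  apply: dotv_ge0_of_segment_min => s s01.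
  (* [P] composed with [m] is affine, so the segment from [g] to [P (m z)] consists of images of
     points of [K]. *)
  have -> : g + s *: (P (m z) - g) = P (m ((1 - s) *: z0 + s *: z)).
    rewrite /g /P /m; apply/rowP => i; rewrite !dotv_lin !mxE.
    by field.
  by apply: z0min; rewrite inE; exact: convex_segment.
Qed.

(** Let the shrinking factor [t = 1/(k+1)] tend to 0: the unit normals of [separate_line_approx]
    have a cluster point on the compact sphere, and both conditions are closed. *)
Lemma separate_line (K : set 'rV[R]_n) (y d : 'rV[R]_n) :
  compact K -> convex_set K -> K° !=set0 -> d != 0 ->
  (forall s, ~ K° (y + s *: d)) ->
  exists u, [/\ u != 0, dotv u d = 0 & forall z, K z -> dotv u z <= dotv u y].
Proof.
move=> Kc Kconv [p Kp] d0 Kyd.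
have t01 (k : nat) : 0 < (k.+1%:R^-1 : R) <= 1.
  by rewrite invr_gt0 ltr0n /= invf_le1 ?ltr0n // ler1n.
have [u uP] := choice (fun k => separate_line_approx K y d p k.+1%:R^-1
  Kc Kconv d0 Kp (t01 k) Kyd).
have [|v [/= v1 vF]] := @compact_sphere (u @ \oo) _.
  by exists 0%N => // k _ /=; have [] := uP k.
have v_in (C : set 'rV[R]_n) : closed C -> (\forall k \near \oo, C (u k)) -> C v.
  move=> Ccl uC; apply: Ccl; move: vF; rewrite clusterE => vF.
  exact: vF.
have dotc (w : 'rV[R]_n) : continuous (fun u : 'rV[R]_n => dotv u w).
  by apply: continuous_dotv; [move=> ?; exact: cvg_id|exact: cst_continuous].
exists v; split.
- by rewrite -dotv_eq0 v1 oner_neq0.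
- apply: (v_in [set u | dotv u d = 0]).
    apply: (@preimage_closed _ _ (fun u => dotv u d) [set x | x = 0]).
      by move=> w _; exact: dotc.
    exact: closed_eq.
  by near=> k; have [] := uP k.
- move=> z Kz; apply/ler_addgt0Pr => e e0.
  suff : dotv v (z - y) <= e by rewrite dotvDr dotvNr; lra.
  apply: (v_in [set u | dotv u (z - y) <= e]).
    apply: (@preimage_closed _ _ (fun u => dotv u (z - y)) [set x | x <= e]).
      by move=> w _; exact: dotc.
    exact: closed_le.
  (* For the normal [u k], the error in [dotv (u k) (z - y) <= 0] is at most [t * enorm (z - p)];
     the added 1 avoids a zero divisor. *)
  have M0 : 0 < enorm (z - p) + 1 by rewrite ltr_wpDl ?enorm_ge0.
  have eM : 0 < e / (enorm (z - p) + 1) by rewrite divr_gt0.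
  near=> k.
  have /= kM : k.+1%:R^-1 < e / (enorm (z - p) + 1).
    by near: k; exact: (near_infty_natSinv_lt (PosNum eM)).
  have [uk1 _ /(_ z Kz)] := uP k.
  have /andP[] := t01 k; move: kM; set t := k.+1%:R^-1 => kM tpos _.
  rewrite !dotv_lin => le1.
  have := dotv_le_enorm (u k) (z - p).
  rewrite {1}/enorm uk1 sqrtr1 mul1r !dotv_lin => le2.
  have : t * (enorm (z - p) + 1) < e by rewrite -ltr_pdivlMr.
  have : t * (dotv (u k) z - dotv (u k) p) <= t * enorm (z - p).
    by rewrite ler_pM2l.
  lra.
Unshelve. all: by end_near. Qed.

End Separation.

(** * Illumination of smooth boundary points, and the diameter *)

Section Illumination.
Context {R : realType} {n : nat}.
Variable K : set 'rV[R]_n.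

(* If the line through [x] and [y] missed the interior of [K], it would lie in
   a support hyperplane at [y], which by uniqueness does not contain [x]. *)
Lemma illuminates_point_smooth (x y u : 'rV[R]_n) :
  compact_convex_body K -> (exists! H, support_hyperplane K y H) ->
  u != 0 -> (forall z, K z -> dotv u z <= dotv u y) -> dotv u y < dotv u x ->
  illuminates_point K x y.
Proof.
move=> [Kc Kconv K0] [H [_ Huniq]] u0 uK ux.
have HE : H = [set z | dotv u z = dotv u y].
  by apply: Huniq; split => //; exists u, (dotv u y).
have xy : x <> y by move=> xy; move: ux; rewrite xy ltxx.
split => //.
- apply/seteqP; split => // w [[t /=]]; rewrite in_itv /= => /andP[t0 t1] <- Kw.
  have := interior_dotv_lt K u _ _ u0 uK Kw.
  rewrite !dotv_lin ltNge => /negP; apply.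
  have : 0 <= (1 - t) * (dotv u x - dotv u y).
    by rewrite mulr_ge0 ?subr_ge0 // ltW.
  lra.
- apply: contrapT => lineN.
  have d0 : x - y != 0 by rewrite subr_eq0; apply/eqP.
  have [s Ks|u' [u'0 u'd u'K]] := separate_line K y (x - y) Kc Kconv K0 d0.
    apply: lineN; exists (y + s *: (x - y)); split => //.
    exists (1 - s) => //=; apply/rowP => i; rewrite !mxE; ring.
  have HE' : H = [set z | dotv u' z = dotv u' y].
    by apply: Huniq; split => //; exists u', (dotv u' y).
  have : H x.
    by rewrite HE' /=; move: u'd; rewrite dotvDr dotvNr => /eqP;
      rewrite subr_eq0 => /eqP.
  by rewrite HE /= => /eqP; rewrite gt_eqF.
Qed.

(** Compactness bounds the set of distances by twice the maximal norm on [K], so its [sup] is a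
    genuine upper bound. *)
Lemma diameter_ubound (x y : 'rV[R]_n) : compact K -> K x -> K y ->
  enorm (x - y) <= diameter K.
Proof.
move=> Kc Kx Ky.
have cf : continuous (fun z : 'rV[R]_n => dotv z z).
  by apply: continuous_dotv => ?; exact: cvg_id.
have [|z0 _ z0max] := EVT_max_rV _ Kc (continuous_subspaceT cf).
  by exists x.
have zle z : K z -> enorm z <= enorm z0.
  by move=> Kz; rewrite ler_wsqrtr // z0max // inE.
apply: ub_le_sup; last by exists x => //; exists y.
exists (enorm z0 + enorm z0) => _ [a Ka [b Kb <-]].
by apply: le_trans (enormD _ _) _; rewrite enormN lerD ?zle.
Qed.

End Illumination.

Theorem proposition1p1 (R : realType) (n : nat) (n_ge1 : (1 <= n)%N)
    (K : set 'rV[R]_n) (K_body : compact_convex_body K)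
    (K_smooth : smooth_boundary K) (eps : R) (eps_gt0 : 0 < eps) :
  exists S : set 'rV[R]_n,
    [/\ (S #= `I_n.+1)%card,
        illuminates S K
      & illumination_distance S K
          <= Num.sqrt ((n * n.+1)%:R / 2) * diameter K + eps].
Proof.
have [Kc Kconv [p Kp_int]] := K_body.
have Kp : K p by exact: nbhs_singleton.
have nR : 0 < n%:R :> R by rewrite ltr0n.
set D := diameter K.
have KD x y : K x -> K y -> enorm (x - y) <= D by exact: diameter_ubound.
have D0 : 0 <= D by apply: le_trans (KD _ _ Kp Kp); exact: enorm_ge0.
have KD2 x y : K x -> K y -> dotv (x - y) (x - y) <= D ^+ 2.
  move=> Kx Ky; rewrite -enorm_sqr lerXn2r ?nnegrE ?enorm_ge0 //.
  exact: KD.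
pose q : R := Num.sqrt ((n * n.+1)%:R / 2).
have q2 : q ^+ 2 = n%:R * (n%:R + 1) / 2.
  by rewrite sqr_sqrtr ?divr_ge0 // natrM -[in LHS]natr1.
(* The final bound is [rho + (r + del) = (n + 1) * r + (2 * n + 1) * del], whose two terms are
   [q * D] and [eps]. *)
pose del := eps / (2 * n%:R + 1).
have den : 0 < 2 * n%:R + 1 :> R by rewrite addr_gt0 // mulr_gt0.
have del0 : 0 < del by rewrite divr_gt0.
have delE : (2 * n%:R + 1) * del = eps by rewrite /del mulrC divfK // gt_eqF.
have n1R : 0 < n%:R + 1 :> R by rewrite addr_gt0.
pose r := q * D / (n%:R + 1).
have r0 : 0 <= r by rewrite divr_ge0 ?mulr_ge0 ?sqrtr_ge0 // ltW.
(* The error [del ^+ 2] in squared distance suffices since [r ^+ 2 + del ^+ 2 <= (r + del) ^+ 2]. *)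
have [|c cK] := jung_approx K (D ^+ 2) (del ^+ 2) _ (exprn_gt0 2 del0) KD2.
  by exists p.
have {}cK y : K y -> enorm (y - c) <= r + del.
  move=> /cK; rewrite -enorm_sqr => h.
  have rd0 : 0 <= r + del by rewrite addr_ge0 // ltW.
  rewrite -(@ler_pXn2r _ 2) ?nnegrE ?enorm_ge0 //; apply: le_trans h _.
  have -> : D ^+ 2 * n%:R / (2 * n.+1%:R) = r ^+ 2.
    rewrite /r expr_div_n exprMn q2 -natr1; field.
    by rewrite gt_eqF // addrC.
  by rewrite sqrrD lerD2r lerDl mulrn_wge0 // mulr_ge0 // ltW.
have [v [vinj v1 vs vs2]] := @regular_simplex R n n_ge1.
(* This circumradius gives inradius [r + del + del]; the second [del] puts a vertex strictly beyond
   each support hyperplane. *)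
pose rho := n%:R * (r + del + del).
have rho0 : 0 < rho by rewrite mulr_gt0 // !ltr_wpDl // addr_ge0 // ltW.
pose s k := c + rho *: v (inord k).
exists (s @` `I_n.+1); split.
- apply: inj_card_eq => i j; rewrite !inE /= => iln jln.
  move=> /addrI/(scalerI (lt0r_neq0 rho0))/vinj/(congr1 val).
  by rewrite /= !inordK.
- move=> y Ky.
  have Kyy : K y.
    have [Kcl _] := Ky; apply: (compact_closed _ Kc) Kcl.
    exact: norm_hausdorff.
  (* The existence half of smoothness supplies the outer normal [u]; uniqueness enters through
     [illuminates_point_smooth]. *)
  have [H [[Hy [u [cc [u0 HE Kuc]]]] _]] := K_smooth y Ky.
  have uy : dotv u y = cc by move: Hy; rewrite HE.
  have [k uk] := simplex_inradius v u n_ge1 v1 (vs u) (vs2 u).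
  exists (s k); first by exists (k : nat) => //=.
  apply: (illuminates_point_smooth K _ _ u) => // [|z Kz|].
  + exact: K_smooth.
  + by rewrite uy; exact: Kuc.
  + have u_gt0 := enorm_gt0 _ u0.
    have le1 := dotv_le_enorm u (y - c).
    have le2 : enorm u * enorm (y - c) <= enorm u * (r + del).
      by rewrite ler_pM2l // cK.
    have le3 : rho * (enorm u / n%:R) <= rho * dotv u (v k) by rewrite ler_pM2l.
    have rhoE : rho * (enorm u / n%:R) = (r + del + del) * enorm u.
      by rewrite /rho; field; rewrite gt_eqF.
    have ud : 0 < del * enorm u by rewrite mulr_gt0.
    move: le1; rewrite /s inord_val !(dotvDr, dotvNr, dotvZr).
    lra.
- apply: ge_sup.
    by exists (enorm (s 0%N - p)); exists (s 0%N); [exists 0%N|exists p].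
  move=> _ [_ [k _ <-] [y Ky <-]].
  have -> : s k - y = rho *: v (inord k) + - (y - c).
    by rewrite /s opprB addrA (addrC c).
  apply: le_trans (enormD _ _) _.
  rewrite enormN enormZ {1}/enorm v1 sqrtr1 mulr1 gtr0_norm //.
  apply: le_trans (lerD (lexx _) (cK y Ky)) _.
  rewrite le_eqVlt; apply/orP; left; apply/eqP.
  rewrite -/q -delE /rho /r; field.
  by rewrite gt_eqF.
Qed.
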